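(* For every positive integer $q$, \[ (1+(-1)^{q+1})\bar T_{1,q}=(-1)^{q+1}\bar t(q+1)-\pi \zeta(\bar q)+((-1)^q-1)2\log(2)\bar t(q)+2\sum_{\substack{2k_1+k_2=q-2\\ k_1,k_2\geq1}} \bar t(2k_1+1)\zeta(k_2+2). \]
   Context: Let $h_n=\sum_{k=1}^n (k-1/2)^{-1}$ for $n\ge0$. The alternating Euler $T$-sum is $\bar T_{1,q}=\sum_{n\ge1}\frac{h_{n-1}}{(n-1/2)^q}(-1)^n$. For $s\ge1$, $\bar t(s)=\sum_{n\ge1}\frac{(-1)^{n-1}}{(n-1/2)^s}$, and $\zeta(\bar s)=\sum_{n\ge1}\frac{(-1)^n}{n^s}$. $\zeta$ denotes the Riemann zeta function.
   Formalization: The sum is taken over k_1, k_2 ≥ 0 with 2k_1+k_2 = q−2, instead of the printed k_1, k_2 ≥ 1; with the printed range the identity is false for every q ≥ 2 (at q = 2 it would read 0 = −π³/4 + π³/12). *)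

(* Defs.v *)
(* Stdlib reals with Coquelicot series. *)
From Stdlib Require Export Reals.
From Coquelicot Require Export Coquelicot.
Open Scope R_scope.

(* Coquelicot's [Series] starts at index 0, so a sum over n >= 1 is written
   with n = S m throughout. *)

Definition h (n : nat) : R := sum_n_m (fun k => / (INR k - / 2)) 1 n.

(* The factor [h m] is h_{n-1} for n = S m. *)
Definition Tbar1 (q : nat) : R :=
  Series (fun m => h m / (INR (S m) - / 2) ^ q * (-1) ^ (S m)).

Definition tbar (s : nat) : R :=
  Series (fun m => (-1) ^ m / (INR (S m) - / 2) ^ s).

Definition zetabar (s : nat) : R :=
  Series (fun m => (-1) ^ (S m) / INR (S m) ^ s).

(* Riemann zeta at an integer s >= 2, the only arguments used. *)
Definition zeta (s : nat) : R :=
  Series (fun m => / INR (S m) ^ s).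

(* Sum of F k1 k2 over integers k1, k2 >= 0 with 2 k1 + k2 = q - 2.  The
   equation is written without truncated subtraction, so the sum is empty for
   q < 2; the bounds k1, k2 <= q exclude no solution.
   The source prints k1, k2 >= 1, a misprint: the identity for Tbar1 then fails
   at q = 2, where it would read 0 = - tbar 3 - PI * zetabar 2, although
   tbar 3 > 7 and - PI * zetabar 2 < PI. *)
Definition sum_2k1_k2 (q : nat) (F : nat -> nat -> R) : R :=
  sum_n (fun k1 =>
    sum_n (fun k2 =>
      if Nat.eqb (2 * k1 + k2 + 2) q then F k1 k2 else 0) q) q.

(* Main.v *)
Require Import Defs.
From Stdlib Require Import Reals Lra Lia.
From Coquelicot Require Import Coquelicot.
Open Scope R_scope.

(** Let [a] range over the half-integers, with sign [e a = (-1) ^ (a - 1/2)], and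
    [k] over the positive integers. Since [e] is odd, twice the convolution on the
    right is [sum_a sum_k e a * sum_(m < q - 1) / (a ^ (m + 1) * k ^ (q - m))], and
    the inner geometric sum equals
    [(/ (k - a) - / k) / a ^ q - / (k ^ q * (k - a))].
    Cut off at [|a| < N] and sum over [k] first. The first part gives digamma
    values at half-integers, that is [2 * ln 2 - h n]. In the second part
    [sum_a e a / (k - a)] tends to [- (-1) ^ k * PI], with error
    [O (1 / (1 + |N - k|))]; so the total error is [O (ln N / N)] even for [q = 1],
    where the double sum does not converge absolutely. *)

(** * Sums and series *)

Lemma sum_n_S (f : nat -> R) (n : nat) : sum_n f (S n) = sum_n f n + f (S n).
Proof. exact (sum_Sn f n). Qed.

Lemma sum_n_0 (f : nat -> R) : sum_n f 0 = f 0%nat.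
Proof. exact (sum_O f). Qed.

Lemma sum_n_ext_R (f g : nat -> R) (n : nat) :
  (forall k, f k = g k) -> sum_n f n = sum_n g n.
Proof. exact (sum_n_ext f g n). Qed.

Lemma sum_n_Rplus (f g : nat -> R) (n : nat) :
  sum_n (fun k => f k + g k) n = sum_n f n + sum_n g n.
Proof. exact (sum_n_plus f g n). Qed.

Lemma sum_n_Rmult_l (c : R) (f : nat -> R) (n : nat) :
  sum_n (fun k => c * f k) n = c * sum_n f n.
Proof. exact (sum_n_mult_l c f n). Qed.

(** The interchange of summations on which the proof rests: one of the two sums is always finite. *)
Lemma is_series_sum_n (f : nat -> nat -> R) (l : nat -> R) (n : nat) :
  (forall i, is_series (f i) (l i)) ->
  is_series (fun k => sum_n (fun i => f i k) n) (sum_n l n).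
Proof.
  intros Hf; induction n as [|n IH].
  - rewrite sum_n_0. apply is_series_ext with (f 0%nat); [|apply Hf].
    intros k; now rewrite sum_n_0.
  - rewrite sum_n_S.
    apply is_series_ext with (fun k => plus (sum_n (fun i => f i k) n) (f (S n) k)).
    + intros k; now rewrite sum_n_S.
    + apply (is_series_plus (V := R_NormedModule)); [exact IH | apply Hf].
Qed.

Lemma is_series_lim (f : nat -> R) (l : R) :
  is_series f l <-> is_lim_seq (sum_n f) l.
Proof. reflexivity. Qed.

Lemma ex_series_alternating (u : nat -> R) :
  Un_decreasing u -> is_lim_seq u 0 -> ex_series (fun n => (-1) ^ n * u n).
Proof.
  intros Hd Hl.
  destruct (alternated_series u Hd) as [l Hl']; [now apply is_lim_seq_Reals|].
  exists l. now apply is_series_Reals.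
Qed.

Lemma pow_ge_base (x : R) (s : nat) : 1 <= x -> (1 <= s)%nat -> x <= x ^ s.
Proof.
  intros Hx Hs. rewrite <- (pow_1 x) at 1. now apply Rle_pow.
Qed.

Lemma is_lim_seq_inv_INR_S : is_lim_seq (fun n => / INR (S n)) 0.
Proof.
  replace (Finite 0) with (Rbar_inv p_infty) by reflexivity.
  apply is_lim_seq_inv; [|discriminate].
  apply (is_lim_seq_incr_1 INR), is_lim_seq_INR.
Qed.

(** * Half-integers and the constants of the theorem *)

(** Kept in this shape, rather than as [INR n + / 2], to match the denominators of [Tbar1] and
    [tbar] by unfolding. *)
Definition half (n : nat) : R := INR (S n) - / 2.

Lemma half_pos (n : nat) : 0 < half n.
Proof. unfold half; rewrite S_INR; pose proof (pos_INR n); lra. Qed.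

Lemma half_S (n : nat) : half (S n) = half n + 1.
Proof. unfold half; rewrite (S_INR (S n)); ring. Qed.

Lemma half_INR (n : nat) : half n = INR n + / 2.
Proof. unfold half; rewrite S_INR; lra. Qed.

(** Twice the difference is an odd integer. *)
Lemma INR_sub_half_neq0 (k n : nat) : INR k - half n <> 0.
Proof.
  unfold half; rewrite INR_IZR_INZ, INR_IZR_INZ.
  set (a := Z.of_nat k); set (b := Z.of_nat (S n)).
  intros H.
  assert (H' : IZR (2 * (a - b) + 1) = 0)
    by (rewrite plus_IZR, mult_IZR, minus_IZR; lra).
  apply eq_IZR in H'; lia.
Qed.

Lemma ex_series_tbar (s : nat) :
  (1 <= s)%nat -> ex_series (fun m => (-1) ^ m / half m ^ s).
Proof.
  intros Hs. apply (ex_series_alternating (fun m => / half m ^ s)).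
  - intros n. apply Rinv_le_contravar; [apply pow_lt, half_pos|].
    apply pow_incr. rewrite half_S. pose proof (half_pos n); lra.
  (* The shift discards [half 0 = 1/2]; from [half 1] on the base is at least 1, so its powers
     dominate it. *)
  - apply is_lim_seq_incr_1.
    apply is_lim_seq_le_le with (fun _ => 0) (fun n => / INR (S n)).
    + intros n. assert (Hh := half_pos (S n)). split.
      * left; now apply Rinv_0_lt_compat, pow_lt.
      * apply Rinv_le_contravar; [apply lt_0_INR; lia|].
        rewrite half_INR in *. rewrite S_INR. pose proof (pos_INR n).
        eapply Rle_trans; [|apply pow_ge_base; [|exact Hs]]; lra.
    + apply is_lim_seq_const.
    + apply is_lim_seq_inv_INR_S.
Qed.

Lemma is_series_tbar (s : nat) :
  (1 <= s)%nat -> is_series (fun m => (-1) ^ m / half m ^ s) (tbar s).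
Proof. intros Hs. now apply Series_correct, ex_series_tbar. Qed.

Lemma is_series_zetabar (s : nat) :
  (1 <= s)%nat ->
  is_series (fun m => (-1) ^ S m / INR (S m) ^ s) (zetabar s).
Proof.
  intros Hs. apply Series_correct.
  apply ex_series_ext with (fun m => scal (-1) ((-1) ^ m * / INR (S m) ^ s)).
  { intros m. unfold scal; simpl; unfold mult; simpl.
    unfold Rdiv; ring. }
  apply (ex_series_scal (V := R_NormedModule)).
  apply (ex_series_alternating (fun m => / INR (S m) ^ s)).
  - intros n. apply Rinv_le_contravar; [apply pow_lt, lt_0_INR; lia|].
    apply pow_incr. split; [apply pos_INR | apply le_INR; lia].
  - apply is_lim_seq_le_le with (fun _ => 0) (fun n => / INR (S n)).
    + intros n. assert (Hn : 1 <= INR (S n)) by (rewrite S_INR; pose proof (pos_INR n); lra).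
      split.
      * left; apply Rinv_0_lt_compat, pow_lt; lra.
      * apply Rinv_le_contravar; [lra | now apply pow_ge_base].
    + apply is_lim_seq_const.
    + apply is_lim_seq_inv_INR_S.
Qed.

(** Comparison with a telescoping series: [1/m^s <= 1/m^2 <= 2 (1/m - 1/(m+1))] for [m >= 1]. *)
Lemma is_series_zeta (s : nat) :
  (2 <= s)%nat -> is_series (fun m => / INR (S m) ^ s) (zeta s).
Proof.
  intros Hs. apply Series_correct.
  apply (ex_series_le (V := R_CompleteNormedModule))
    with (fun m => 2 * (/ INR (S m) - / INR (S (S m)))).
  - intros m. assert (Hm : 1 <= INR (S m)) by (rewrite S_INR; pose proof (pos_INR m); lra).
    change (norm (/ INR (S m) ^ s)) with (Rabs (/ INR (S m) ^ s)).
    rewrite Rabs_pos_eq by (left; apply Rinv_0_lt_compat, pow_lt; lra).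
    apply Rle_trans with (/ INR (S m) ^ 2).
    + apply Rinv_le_contravar; [apply pow_lt; lra | now apply Rle_pow].
    + rewrite (S_INR (S m)). set (x := INR (S m)) in *.
      replace (2 * (/ x - / (x + 1))) with (/ x ^ 2 + (x - 1) / (x ^ 2 * (x + 1)))
        by (field; lra).
      assert (0 <= (x - 1) / (x ^ 2 * (x + 1))); [|lra].
      apply Rdiv_le_0_compat; [lra|].
      apply Rmult_lt_0_compat; [apply pow_lt|]; lra.
  - exists (2 * (1 - 0)).
    apply is_series_lim.
    apply is_lim_seq_ext with (fun n => 2 * (1 - / INR (S (S n)))).
    + induction n as [|n IH].
      * rewrite sum_n_0. simpl; lra.
      * rewrite sum_n_S, <- IH. ring.
    + apply is_lim_seq_mult'; [apply is_lim_seq_const|].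
      apply is_lim_seq_minus'; [apply is_lim_seq_const|].
      apply (is_lim_seq_incr_1 (fun n => / INR (S n))), is_lim_seq_inv_INR_S.
Qed.

(** * Harmonic numbers and [ln 2] *)

Definition harmonic (n : nat) : R := sum_n_m (fun k => / INR k) 1 n.

Lemma harmonic_S (n : nat) : harmonic (S n) = harmonic n + / INR (S n).
Proof. unfold harmonic. now rewrite sum_n_Sm by lia. Qed.

Lemma harmonic_0 : harmonic 0 = 0.
Proof. unfold harmonic. now rewrite sum_n_m_zero by lia. Qed.

Lemma h_S (n : nat) : h (S n) = h n + / half n.
Proof. unfold h. now rewrite sum_n_Sm by lia. Qed.

Lemma h_0 : h 0 = 0.
Proof. unfold h. now rewrite sum_n_m_zero by lia. Qed.

(** Termwise, from [k - 1/2 >= k/2] for [k >= 1]. *)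
Lemma h_le_harmonic (n : nat) : h n <= 2 * harmonic n.
Proof.
  induction n as [|n IH]; [rewrite h_0, harmonic_0; lra|].
  rewrite h_S, harmonic_S.
  assert (/ half n <= 2 * / INR (S n)); [|lra].
  replace (2 * / INR (S n)) with (/ (INR (S n) / 2))
    by (field; apply not_0_INR; lia).
  assert (Hn : 1 <= INR (S n)) by (rewrite S_INR; pose proof (pos_INR n); lra).
  apply Rinv_le_contravar; unfold half; lra.
Qed.

Lemma harmonic_le (m n : nat) : (m <= n)%nat -> harmonic m <= harmonic n.
Proof.
  intros Hmn; induction Hmn as [|n Hmn IH]; [lra|].
  rewrite harmonic_S.
  assert (0 < / INR (S n)) by (apply Rinv_0_lt_compat, lt_0_INR; lia); lra.
Qed.

(** A Cesàro mean of the null sequence [1/k]. This is the rate at which the truncation error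
    vanishes. *)
Lemma harmonic_div_lim : is_lim_seq (fun n => harmonic (S n) / INR (S n)) 0.
Proof.
  apply (is_lim_seq_incr_1 (fun n => harmonic n / INR n)).
  apply is_lim_seq_ext_loc
    with (fun n => sum_f_R0 (fun k => / INR (S k)) (pred n) / INR n).
  - exists 1%nat; intros [|n] Hn; [lia|]. f_equal. simpl pred.
    clear Hn; induction n as [|n IH].
    + rewrite harmonic_S, harmonic_0; simpl; lra.
    + rewrite harmonic_S, <- IH; reflexivity.
  - apply is_lim_seq_Reals, Cesaro_1, is_lim_seq_Reals, is_lim_seq_inv_INR_S.
Qed.

Lemma ln_le_sub_1 (x : R) : 0 < x -> ln x <= x - 1.
Proof.
  intros Hx. pose proof (exp_ineq1_le (ln x)). rewrite exp_ln in H; lra.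
Qed.

Lemma ln_step_bounds (x : R) :
  1 <= x -> / (x + 1) <= ln (x + 1) - ln x <= / x.
Proof.
  intros Hx. split.
  - assert (H : ln (x / (x + 1)) <= x / (x + 1) - 1)
      by (apply ln_le_sub_1, Rdiv_lt_0_compat; lra).
    rewrite ln_div in H by lra.
    replace (x / (x + 1) - 1) with (- / (x + 1)) in H by (field; lra). lra.
  - assert (H : ln ((x + 1) / x) <= (x + 1) / x - 1)
      by (apply ln_le_sub_1, Rdiv_lt_0_compat; lra).
    rewrite ln_div in H by lra.
    replace ((x + 1) / x - 1) with (/ x) in H by (field; lra). lra.
Qed.

Lemma harmonic_sub_bounds (n m : nat) :
  ln (INR (n + m) + 2) - ln (INR n + 2)
    <= harmonic (S n + m) - harmonic (S n)
    <= ln (INR (n + m) + 1) - ln (INR n + 1).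
Proof.
  induction m as [|m IH].
  - rewrite !Nat.add_0_r; lra.
  - rewrite !Nat.add_succ_r, harmonic_S.
    rewrite !S_INR. change (S n + m)%nat with (S (n + m)). rewrite S_INR.
    change (S n + m)%nat with (S (n + m)) in IH.
    set (x := INR (n + m)) in *. assert (0 <= x) by apply pos_INR.
    pose proof (ln_step_bounds (x + 1) ltac:(lra)).
    pose proof (ln_step_bounds (x + 2) ltac:(lra)).
    replace (x + 1 + 2) with (x + 2 + 1) by ring.
    replace (x + 1 + 1) with (x + 2) in * by ring.
    replace (x + 2 + 1) with (x + 3) in * by ring.
    lra.
Qed.

(** [h n] is twice the sum of the reciprocals of the odd numbers below [2n], that is
    [2 H_{2n} - H_n]. *)
Lemma h_sub_harmonic (n : nat) :
  h n - harmonic n = 2 * (harmonic (n + n) - harmonic n).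
Proof.
  induction n as [|n IH].
  - rewrite h_0, harmonic_0; simpl; rewrite harmonic_0; ring.
  - rewrite Nat.add_succ_r, Nat.add_succ_l, h_S, !harmonic_S.
    assert (H : / half n = 2 * / INR (S (n + n))).
    { rewrite half_INR, S_INR, plus_INR. pose proof (pos_INR n). field. lra. }
    assert (H' : / INR (S n) = 2 * / INR (S (S (n + n)))).
    { rewrite !S_INR, plus_INR. pose proof (pos_INR n). field. lra. }
    lra.
Qed.

Lemma lim_h_sub_harmonic : is_lim_seq (fun n => h n - harmonic n) (2 * ln 2).
Proof.
  apply is_lim_seq_incr_1.
  apply is_lim_seq_le_le with
    (fun n => 2 * ln 2 - 2 * / INR (S n)) (fun _ => 2 * ln 2).
  - intros n. rewrite h_sub_harmonic.
    (* With [m = n + 1] the upper bound is exactly [ln 2]; the lower one misses it by at most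
       [ln (n + 2) - ln (n + 1) <= 1/(n + 1)]. *)
    pose proof (harmonic_sub_bounds n (S n)) as H.
    rewrite Nat.add_succ_r, S_INR, plus_INR in H. rewrite S_INR.
    set (x := INR n) in *. assert (0 <= x) by apply pos_INR.
    assert (E1 : ln (x + x + 1 + 1) = ln 2 + ln (x + 1))
      by (rewrite <- ln_mult by lra; f_equal; ring).
    assert (E2 : ln 2 + ln (x + 1) <= ln (x + x + 1 + 2)).
    { rewrite <- ln_mult by lra. apply ln_le; lra. }
    pose proof (ln_step_bounds (x + 1) ltac:(lra)) as [_ E3].
    replace (x + 1 + 1) with (x + 2) in E3 by ring.
    lra.
  - replace (Finite (2 * ln 2)) with (Finite (2 * ln 2 - 2 * 0)) by (f_equal; ring).
    apply is_lim_seq_minus'; [apply is_lim_seq_const|].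
    apply is_lim_seq_mult'; [apply is_lim_seq_const | apply is_lim_seq_inv_INR_S].
  - apply is_lim_seq_const.
Qed.

(** * Digamma values at half-integers *)

Lemma is_series_sub_half_0 :
  is_series (fun k => / (INR (S k) - half 0) - / INR (S k)) (2 * ln 2).
Proof.
  apply is_series_lim.
  apply is_lim_seq_ext with (fun n => h (S n) - harmonic (S n)).
  - assert (E : forall k, INR (S k) - half 0 = half k)
      by (intros k; unfold half; simpl (INR 1); lra).
    induction n as [|n IH].
    + rewrite sum_n_0, E, h_S, harmonic_S, h_0, harmonic_0; ring.
    + rewrite sum_n_S, <- IH, E, (h_S (S n)), (harmonic_S (S n)); ring.
  - apply (is_lim_seq_incr_1 (fun n => h n - harmonic n)), lim_h_sub_harmonic.
Qed.

(** The functional equation [psi (z + 1) = psi z + 1/z] in series form: shifting the first index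
    adds the boundary term [/ (- x)] and drops one that tends to 0. *)
Lemma is_series_shift_diff (x l : R) :
  is_series (fun k => / (INR (S k) - x) - / INR (S k)) l <->
  is_series (fun k => / (INR k - x) - / INR (S k)) (l + / (- x)).
Proof.
  assert (Hsum : forall n, / (- x) - / (INR (S n) - x)
      + sum_n (fun k => / (INR (S k) - x) - / INR (S k)) n
      = sum_n (fun k => / (INR k - x) - / INR (S k)) n).
  { induction n as [|n IH].
    - rewrite !sum_n_0. change (INR 0) with 0. replace (0 - x) with (- x) by ring. ring.
    - rewrite !sum_n_S, <- IH. ring. }
  assert (H0 : is_lim_seq (fun n => / (INR (S n) - x)) 0).
  { replace (Finite 0) with (Rbar_inv p_infty) by reflexivity.
    apply is_lim_seq_inv; [|discriminate].
    apply is_lim_seq_minus with p_infty x; [|apply is_lim_seq_const|reflexivity].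
    apply (is_lim_seq_incr_1 INR), is_lim_seq_INR. }
  rewrite !is_series_lim. split; intros H.
  - apply is_lim_seq_ext with (1 := Hsum).
    replace (l + / (- x)) with (/ (- x) - 0 + l) by ring.
    apply is_lim_seq_plus'; [|exact H].
    apply is_lim_seq_minus'; [apply is_lim_seq_const | exact H0].
  - apply is_lim_seq_ext with
      (fun n => sum_n (fun k => / (INR k - x) - / INR (S k)) n
                - (/ (- x) - / (INR (S n) - x))).
    { intros n; rewrite <- Hsum; ring. }
    replace l with (l + / (- x) - (/ (- x) - 0)) by ring.
    apply is_lim_seq_minus'; [exact H|].
    apply is_lim_seq_minus'; [apply is_lim_seq_const | exact H0].
Qed.

(* The digamma value [- psi (1 - half n) - gamma]. *)
Lemma is_series_sub_half (n : nat) :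
  is_series (fun k => / (INR (S k) - half n) - / INR (S k)) (2 * ln 2 - h n).
Proof.
  induction n as [|n IH].
  - rewrite h_0, Rminus_0_r. apply is_series_sub_half_0.
  - apply is_series_shift_diff in IH.
    rewrite h_S. pose proof (half_pos n).
    replace (2 * ln 2 - (h n + / half n)) with (2 * ln 2 - h n + / (- half n))
      by (field; lra).
    apply is_series_ext with (2 := IH).
    intros k. rewrite half_S, (S_INR k). do 2 f_equal; ring.
Qed.

(** The value [- psi (1 + half n) - gamma]. The shift is now used from right to left, starting from
    the same base series. *)
Lemma is_series_add_half (n : nat) :
  is_series (fun k => / (INR (S k) + half n) - / INR (S k)) (2 * ln 2 - h (S n)).
Proof.
  induction n as [|n IH].
  - apply is_series_ext with (fun k => / (INR (S k) - - half 0) - / INR (S k)).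
    { intros k; do 2 f_equal; ring. }
    apply is_series_shift_diff.
    replace (2 * ln 2 - h 1 + / (- - half 0)) with (2 * ln 2)
      by (rewrite h_S, h_0, Ropp_involutive; ring).
    apply is_series_ext with (2 := is_series_sub_half_0).
    intros k. rewrite S_INR. unfold half; simpl (INR 1). do 2 f_equal; lra.
  - apply is_series_ext with (fun k => / (INR (S k) - - half (S n)) - / INR (S k)).
    { intros k; do 2 f_equal; ring. }
    apply is_series_shift_diff.
    replace (2 * ln 2 - h (S (S n)) + / (- - half (S n))) with (2 * ln 2 - h (S n))
      by (rewrite (h_S (S n)), Ropp_involutive; ring).
    apply is_series_ext with (2 := IH).
    intros k. rewrite half_S, (S_INR k). do 2 f_equal; ring.
Qed.

(** * The partial fractions of [pi / cos] at the integers *)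

(** The first [n] terms of [2 - 2/3 + 2/5 - ...], whose sum is [PI / 2]. *)
Definition leibniz (n : nat) : R := sum_n_m (fun k => (-1) ^ S k / (INR k - / 2)) 1 n.

Lemma leibniz_S (n : nat) : leibniz (S n) = leibniz n + (-1) ^ n / half n.
Proof.
  unfold leibniz. rewrite sum_n_Sm by lia. apply (f_equal (Rplus _)).
  fold (half n). f_equal. simpl; ring.
Qed.

Lemma leibniz_0 : leibniz 0 = 0.
Proof. unfold leibniz. now rewrite sum_n_m_zero by lia. Qed.

Lemma leibniz_PI_tg (n : nat) : leibniz (S n) = 2 * sum_f_R0 (tg_alt PI_tg) n.
Proof.
  assert (E : forall k, (-1) ^ k / half k = 2 * tg_alt PI_tg k).
  { intros k. unfold tg_alt, PI_tg. rewrite half_INR, plus_INR, mult_INR.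
    simpl (INR 2); simpl (INR 1). pose proof (pos_INR k). field. lra. }
  induction n as [|n IH].
  - rewrite leibniz_S, leibniz_0, E; simpl; ring.
  - rewrite leibniz_S, IH, E, tech5; ring.
Qed.

(** Consecutive partial sums enclose the limit, so the error is at most the next term. The empty sum
    [n = 0] is treated apart, by [PI <= 4]. *)
Lemma leibniz_dist (n : nat) : Rabs (leibniz n - PI / 2) <= / half n.
Proof.
  assert (Hb : forall m, leibniz (S (S (2 * m))) <= PI / 2 <= leibniz (S (2 * m))).
  { intros m. rewrite !leibniz_PI_tg. pose proof (Alt_PI_ineq m).
    rewrite Alt_PI_eq in H. lra. }
  apply Rabs_le_between.
  destruct n as [|n].
  { rewrite leibniz_0. unfold half; simpl (INR 1).
    replace (/ (1 - / 2)) with 2 by field. pose proof PI_4; pose proof PI_RGT_0; lra. }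
  destruct (Nat.Even_or_Odd n) as [[m ->]|[m ->]].
  - pose proof (Hb m) as [H1 H2]. rewrite leibniz_S in H1.
    assert (E : (-1) ^ S (2 * m) = -1) by apply pow_1_odd. rewrite E in H1.
    pose proof (Rinv_0_lt_compat _ (half_pos (S (2 * m)))). lra.
  - replace (2 * m + 1)%nat with (S (2 * m)) by lia.
    pose proof (Hb m) as [H1 _].
    pose proof (Hb (S m)) as [_ H2].
    replace (2 * S m)%nat with (S (S (2 * m))) in H2 by lia.
    rewrite leibniz_S in H2.
    assert (E : (-1) ^ S (S (2 * m)) = 1).
    { replace (S (S (2 * m))) with (2 * S m)%nat by lia. apply pow_1_even. }
    rewrite E in H2.
    pose proof (Rinv_0_lt_compat _ (half_pos (S (S (2 * m))))). lra.
Qed.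

(** The part [|a| < N + 1] of the expansion [sum_a e a / (x - a)] of [- PI / cos (PI x)] at [x = k].
    The terms of [a] and [- a] are paired; [e] being odd gives the minus sign. *)
Definition sec_partial (N k : nat) : R :=
  sum_n (fun n => (-1) ^ n * (/ (INR k - half n) - / (INR k + half n))) N.

Lemma sec_partial_S (N k : nat) :
  sec_partial (S N) k = sec_partial N k
    + (-1) ^ S N * (/ (INR k - half (S N)) - / (INR k + half (S N))).
Proof. apply sum_n_S. Qed.

Lemma pow_m1_sqr (n : nat) : (-1) ^ n * (-1) ^ n = 1.
Proof. rewrite <- pow_add. replace (n + n)%nat with (2 * n)%nat by lia. apply pow_1_even. Qed.

(* The substitution [b = k - a] turns the sum over half-integers [a] into a
   Leibniz sum over [b]. *)
Lemma sec_partial_above (N d : nat) :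
  sec_partial N (S N + d)
  = - (-1) ^ (S N + d) * (leibniz (S N + S N + d) - leibniz d).
Proof.
  revert d; induction N as [|N IH]; intros d.
  - unfold sec_partial. rewrite sum_n_0. simpl Nat.add.
    rewrite !leibniz_S. rewrite half_S.
    replace (INR (S d) - half 0) with (half d) by (unfold half; simpl (INR 1); lra).
    replace (INR (S d) + half 0) with (half d + 1) by (unfold half; simpl (INR 1); lra).
    pose proof (half_pos d).
    transitivity ((-1) ^ d * (-1) ^ d * (/ half d - / (half d + 1))).
    + rewrite pow_m1_sqr; simpl; ring.
    + simpl; field; lra.
  - rewrite sec_partial_S.
    (* Seen from the smaller cutoff, the same [k] lies one step further away. The two new terms
       extend the Leibniz segment by one at each end. *)
    replace (S (S N) + d)%nat with (S N + S d)%nat by lia.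
    rewrite IH.
    replace (S (S N) + S (S N) + d)%nat with (S (S N + S N + S d)) by lia.
    rewrite (leibniz_S (S N + S N + S d)), (leibniz_S d).
    replace (INR (S N + S d) - half (S N)) with (half d)
      by (rewrite !half_INR, plus_INR, !S_INR; lra).
    replace (INR (S N + S d) + half (S N)) with (half (S N + S N + S d))
      by (rewrite !half_INR, !plus_INR, !S_INR; lra).
    pose proof (half_pos d). pose proof (half_pos (S N + S N + S d)).
    rewrite !pow_add, (pow_m1_sqr (S N)).
    set (e := (-1) ^ S N). set (f := (-1) ^ d).
    replace ((-1) ^ S d) with (- f) by (unfold f; simpl; ring).
    assert (Hf : f * f = 1) by apply pow_m1_sqr.
    set (L := leibniz (S N + S N + S d)). set (L' := leibniz d).
    set (x := half d) in *. set (y := half (S N + S N + S d)) in *.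
    replace (e * (/ x - / y)) with (e * (f * f) * (/ x - / y)) by (rewrite Hf; ring).
    unfold Rdiv; ring.
Qed.

(** Once the cutoff passes [S k], the differences [b] take both signs. Positive and negative [b]
    each give an initial Leibniz segment, so the two add up. At [d = 0] this meets
    [sec_partial_above]. *)
Lemma sec_partial_below (k d : nat) :
  sec_partial (k + d) (S k)
  = - (-1) ^ S k * (leibniz (S k + S k + d) + leibniz d).
Proof.
  induction d as [|d IH].
  - replace (S k) with (S (k + 0) + 0)%nat at 1 by lia.
    rewrite sec_partial_above, leibniz_0, !Nat.add_0_r. ring.
  - rewrite Nat.add_succ_r, sec_partial_S, IH, (Nat.add_succ_r (S k + S k)),
      (leibniz_S (S k + S k + d)), (leibniz_S d).
    replace (INR (S k) - half (S (k + d))) with (- half d)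
      by (rewrite !half_INR, !S_INR, plus_INR; lra).
    replace (INR (S k) + half (S (k + d))) with (half (S k + S k + d))
      by (rewrite !half_INR, !plus_INR, !S_INR, plus_INR; lra).
    pose proof (half_pos d). pose proof (half_pos (S k + S k + d)).
    rewrite !pow_add, (pow_m1_sqr (S k)).
    replace ((-1) ^ S (k + d)) with ((-1) ^ S k * (-1) ^ d)
      by (simpl; rewrite pow_add; ring).
    unfold Rdiv. rewrite Rinv_opp. ring.
Qed.

Lemma half_inv_add_le (d m : nat) : / half (m + d) <= / half d.
Proof.
  apply Rinv_le_contravar; [apply half_pos|].
  rewrite !half_INR, plus_INR. pose proof (pos_INR m); lra.
Qed.

Lemma Rabs_pow_m1_mult (n : nat) (x : R) : Rabs ((-1) ^ n * x) = Rabs x.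
Proof. rewrite Rabs_mult, pow_1_abs; ring. Qed.

(** The two Leibniz sums have the same limit [PI / 2], which cancels in their difference; two errors
    of at most [/ half d] remain. *)
Lemma sec_partial_above_bound (N d : nat) :
  Rabs (sec_partial N (S N + d)) <= 2 * / half d.
Proof.
  rewrite sec_partial_above, Ropp_mult_distr_l_reverse, Rabs_Ropp, Rabs_pow_m1_mult.
  replace (leibniz (S N + S N + d) - leibniz d)
    with (leibniz (S N + S N + d) - PI / 2 - (leibniz d - PI / 2)) by ring.
  pose proof (leibniz_dist d). pose proof (leibniz_dist (S N + S N + d)).
  pose proof (half_inv_add_le d (S N + S N)).
  eapply Rle_trans; [apply Rabs_triang|]. rewrite Rabs_Ropp. lra.
Qed.

(** Here the two limits [PI / 2] add up to [PI]. *)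
Lemma sec_partial_below_bound (k d : nat) :
  Rabs (sec_partial (k + d) (S k) + PI * (-1) ^ S k) <= 2 * / half d.
Proof.
  rewrite sec_partial_below.
  replace (- (-1) ^ S k * (leibniz (S k + S k + d) + leibniz d) + PI * (-1) ^ S k)
    with (- ((-1) ^ S k * (leibniz (S k + S k + d) - PI / 2 + (leibniz d - PI / 2))))
    by field.
  rewrite Rabs_Ropp, Rabs_pow_m1_mult.
  pose proof (leibniz_dist d). pose proof (leibniz_dist (S k + S k + d)).
  pose proof (half_inv_add_le d (S k + S k)).
  eapply Rle_trans; [apply Rabs_triang|]. lra.
Qed.

(** * The limit of the sums [sum_k sec_partial N k / k ^ q] *)

Lemma Rabs_div_pow_le (k q : nat) (x b : R) :
  (1 <= q)%nat -> Rabs x <= b -> Rabs (/ INR (S k) ^ q * x) <= / INR (S k) * b.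
Proof.
  intros Hq Hx.
  assert (Hk : 1 <= INR (S k)) by (rewrite S_INR; pose proof (pos_INR k); lra).
  rewrite Rabs_mult, Rabs_pos_eq by (left; apply Rinv_0_lt_compat, pow_lt; lra).
  apply Rmult_le_compat; [|apply Rabs_pos| |exact Hx].
  - left; apply Rinv_0_lt_compat, pow_lt; lra.
  - apply Rinv_le_contravar; [lra | now apply pow_ge_base].
Qed.

(** The error at [x = m + 1] is at most [2 / (x y)] with [y = half (N - m)]. Since
    [1/(x y) = (1/x + 1/y) / (x + y)] and [x + y >= N + 1], the sum of the errors becomes harmonic
    sums divided by [N + 1]. *)
Lemma sum_sec_partial_below_bound (q N M : nat) :
  (1 <= q)%nat -> (M <= N)%nat ->
  Rabs (sum_n (fun k => / INR (S k) ^ q * (sec_partial N (S k) + PI * (-1) ^ S k)) M)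
  <= 2 * / INR (S N) * (harmonic (S M) + h (S N) - h (N - M)).
Proof.
  intros Hq.
  assert (Hterm : forall m, (m <= N)%nat ->
    Rabs (/ INR (S m) ^ q * (sec_partial N (S m) + PI * (-1) ^ S m))
    <= 2 * / INR (S N) * (/ INR (S m) + / half (N - m))).
  { intros m Hm. replace N with (m + (N - m))%nat at 1 by lia.
    eapply Rle_trans;
      [apply Rabs_div_pow_le; [exact Hq | apply sec_partial_below_bound]|].
    pose proof (half_pos (N - m)).
    assert (Hm1 : 0 < INR (S m)) by (apply lt_0_INR; lia).
    assert (HN : 0 < INR (S N)) by (apply lt_0_INR; lia).
    assert (Hsum : INR (S N) <= INR (S m) + half (N - m)).
    { rewrite half_INR, minus_INR, !S_INR by lia. lra. }
    set (x := INR (S m)) in *; set (y := half (N - m)) in *; set (n := INR (S N)) in *.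
    replace (/ x * (2 * / y)) with (2 * (/ x + / y) * / (x + y)) by (field; lra).
    replace (2 * / n * (/ x + / y)) with (2 * (/ x + / y) * / n) by ring.
    apply Rmult_le_compat_l.
    - pose proof (Rinv_0_lt_compat x Hm1); pose proof (Rinv_0_lt_compat y H); lra.
    - now apply Rinv_le_contravar. }
  induction M as [|M IH]; intros HM.
  - rewrite sum_n_0. eapply Rle_trans; [now apply Hterm|].
    rewrite Nat.sub_0_r, harmonic_S, harmonic_0, h_S. apply Req_le; ring.
  - rewrite sum_n_S. eapply Rle_trans; [apply Rabs_triang|].
    specialize (IH ltac:(lia)). specialize (Hterm (S M) HM).
    rewrite (harmonic_S (S M)).
    replace (N - M)%nat with (S (N - S M)) in IH by lia.
    rewrite (h_S (N - S M)) in IH.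
    eapply Rle_trans; [apply Rplus_le_compat; [exact IH | exact Hterm]|].
    apply Req_le; ring.
Qed.

(** Up to index [N] the terms follow those of [- PI * zetabar q]; the later ones only add to the
    error. The bound is uniform in [J], so it survives the limit in [J]. *)
Lemma sum_sec_partial_bound (q N J : nat) :
  (1 <= q)%nat ->
  Rabs (sum_n (fun k => / INR (S k) ^ q * sec_partial N (S k)) (N + J)
        + PI * sum_n (fun k => (-1) ^ S k / INR (S k) ^ q) N)
  <= 8 * (harmonic (S N) / INR (S N)).
Proof.
  intros Hq.
  assert (HN : 0 < INR (S N)) by (apply lt_0_INR; lia).
  set (Z := PI * sum_n (fun k => (-1) ^ S k / INR (S k) ^ q) N).
  set (f := fun k => / INR (S k) ^ q * sec_partial N (S k)).
  (* The second bracket is the sum of [1/j - 1/(N + 1 + j)] over [1 <= j <= J], which bounds the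
     tail. *)
  assert (Hbound : Rabs (sum_n f (N + J) + Z)
    <= 2 * / INR (S N) * (harmonic (S N) + h (S N))
       + 2 * / INR (S N) * (harmonic J - harmonic (S N + J) + harmonic (S N))).
  { induction J as [|J IH].
    - rewrite !Nat.add_0_r, harmonic_0.
      replace (sum_n f N + Z) with
        (sum_n (fun k => / INR (S k) ^ q * (sec_partial N (S k) + PI * (-1) ^ S k)) N).
      + pose proof (sum_sec_partial_below_bound q N N Hq (le_n N)) as H.
        rewrite Nat.sub_diag, h_0 in H.
        eapply Rle_trans; [exact H|]. apply Req_le; ring.
      + unfold Z, f. rewrite <- sum_n_Rmult_l, <- sum_n_Rplus. apply sum_n_ext_R.
        intros k. unfold Rdiv; ring.
    - rewrite Nat.add_succ_r, sum_n_S, Nat.add_succ_r, !harmonic_S.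
      assert (Hf : Rabs (f (S (N + J)))
        <= 2 * / INR (S N) * (/ INR (S J) - / INR (S (S N + J)))).
      { unfold f. replace (S (S (N + J))) with (S N + S J)%nat at 2 by lia.
        eapply Rle_trans;
          [apply Rabs_div_pow_le; [exact Hq | apply sec_partial_above_bound]|].
        replace (S (S N + J)) with (S N + S J)%nat by lia.
        replace (S (S (N + J))) with (S N + S J)%nat by lia.
        rewrite plus_INR.
        assert (HJ : 0 < INR (S J)) by (apply lt_0_INR; lia).
        replace (2 * / INR (S N) * (/ INR (S J) - / (INR (S N) + INR (S J))))
          with (/ (INR (S N) + INR (S J)) * (2 * / INR (S J))) by (field; lra).
        apply Rmult_le_compat_l; [left; apply Rinv_0_lt_compat; lra|].
        apply Rmult_le_compat_l; [lra|].
        apply Rinv_le_contravar; [exact HJ|]. rewrite half_INR; lra. }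
      replace (sum_n f (N + J) + f (S (N + J)) + Z)
        with (sum_n f (N + J) + Z + f (S (N + J))) by ring.
      eapply Rle_trans; [apply Rabs_triang|].
      eapply Rle_trans; [apply Rplus_le_compat; [exact IH | exact Hf]|].
      apply Req_le. rewrite harmonic_S. ring. }
  eapply Rle_trans; [exact Hbound|].
  (* With [H = harmonic (S N)], the brackets are at most [H + 2 H] and [H]; the common factor 2 then
     gives 8. *)
  pose proof (harmonic_le J (S N + J) ltac:(lia)).
  pose proof (h_le_harmonic (S N)).
  replace (8 * (harmonic (S N) / INR (S N)))
    with (2 * / INR (S N) * (4 * harmonic (S N))) by (unfold Rdiv; ring).
  rewrite <- Rmult_plus_distr_l. apply Rmult_le_compat_l; [|lra].
  pose proof (Rinv_0_lt_compat _ HN); lra.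
Qed.

(** First [J] tends to infinity for fixed [N], then [N] does. The second limit uses only convergence
    of the partial sums of [zetabar q], which includes [q = 1]. *)
Lemma lim_series_sec_partial (q : nat) (U : nat -> R) :
  (1 <= q)%nat ->
  (forall N, is_series (fun k => / INR (S k) ^ q * sec_partial N (S k)) (U N)) ->
  is_lim_seq U (- PI * zetabar q).
Proof.
  intros Hq HU.
  set (pz := sum_n (fun k => (-1) ^ S k / INR (S k) ^ q)).
  assert (Hbound : forall N, Rabs (U N + PI * pz N)
    <= 8 * (harmonic (S N) / INR (S N))).
  { intros N.
    change (Rbar_le (Rabs (U N + PI * pz N)) (8 * (harmonic (S N) / INR (S N)))).
    apply is_lim_seq_le with
      (fun J => Rabs (sum_n (fun k => / INR (S k) ^ q * sec_partial N (S k)) (J + N)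
                      + PI * pz N))
      (fun _ => 8 * (harmonic (S N) / INR (S N))).
    - intros J. rewrite Nat.add_comm. now apply sum_sec_partial_bound.
    - apply (is_lim_seq_abs _ (Finite _)).
      apply is_lim_seq_plus'; [|apply is_lim_seq_const].
      apply -> (is_lim_seq_incr_n (sum_n (fun k => / INR (S k) ^ q * sec_partial N (S k)))).
      apply is_series_lim, HU.
    - apply is_lim_seq_const. }
  apply is_lim_seq_ext with (fun N => U N + PI * pz N - PI * pz N).
  { intros N; ring. }
  replace (- PI * zetabar q) with (0 - PI * zetabar q) by ring.
  apply is_lim_seq_minus'.
  - apply is_lim_seq_abs_0.
    apply is_lim_seq_le_le with (fun _ => 0) (fun N => 8 * (harmonic (S N) / INR (S N))).
    + intros N; split; [apply Rabs_pos | apply Hbound].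
    + apply is_lim_seq_const.
    + replace (Finite 0) with (Finite (8 * 0)) by (f_equal; ring).
      apply is_lim_seq_mult'; [apply is_lim_seq_const | apply harmonic_div_lim].
  - apply is_lim_seq_mult'; [apply is_lim_seq_const|].
    apply is_series_lim. now apply is_series_zetabar.
Qed.

(** * The finite partial fraction identity *)

Lemma sum_n_delta (F : nat -> R) (p M : nat) :
  sum_n (fun j => if Nat.eqb j p then F j else 0) M
  = (if Nat.leb p M then F p else 0) :> R.
Proof.
  induction M as [|M IH].
  - rewrite sum_n_0. now destruct p.
  - rewrite sum_n_S, IH.
    destruct (Nat.leb_spec p M), (Nat.leb_spec p (S M)), (Nat.eqb_spec (S M) p);
      try lia; subst; ring.
Qed.

(** The equation determines [k2] from [k1]; the guard ensures that the subtraction is exact. *)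
Lemma sum_2k1_k2_eq (q : nat) (F : nat -> nat -> R) :
  sum_2k1_k2 q F
  = sum_n (fun i => if Nat.leb (2 * i + 2) q then F i (q - (2 * i + 2))%nat else 0) q.
Proof.
  unfold sum_2k1_k2. apply sum_n_ext_R; intros i.
  destruct (Nat.leb_spec (2 * i + 2) q) as [Hi|Hi].
  - rewrite (sum_n_ext_R _ (fun j => if Nat.eqb j (q - (2 * i + 2)) then F i j else 0)).
    + rewrite sum_n_delta. destruct (Nat.leb_spec (q - (2 * i + 2)) q); [easy|lia].
    + intros j. destruct (Nat.eqb_spec (2 * i + j + 2) q),
        (Nat.eqb_spec j (q - (2 * i + 2))); try lia; easy.
  - rewrite (sum_n_ext_R _ (fun j => 0 * 0)).
    + rewrite sum_n_Rmult_l; ring.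
    + intros j. destruct (Nat.eqb_spec (2 * i + j + 2) q); [lia|ring].
Qed.

(** Pairs with [k2 >= 1] come from [q] by raising [k2]; those with [k2 = 0] form the last sum. This
    drives the induction for the partial fractions. *)
Lemma sum_2k1_k2_S (q : nat) (F : nat -> nat -> R) :
  sum_2k1_k2 (S q) F
  = sum_2k1_k2 q (fun i j => F i (S j))
    + sum_n (fun i => if Nat.eqb (2 * i + 1) q then F i 0%nat else 0) q.
Proof.
  rewrite !sum_2k1_k2_eq, sum_n_S, <- sum_n_Rplus.
  destruct (Nat.leb_spec (2 * S q + 2) (S q)); [lia|]. rewrite Rplus_0_r.
  apply sum_n_ext_R; intros i.
  destruct (Nat.leb_spec (2 * i + 2) (S q)), (Nat.leb_spec (2 * i + 2) q),
    (Nat.eqb_spec (2 * i + 1) q); try lia.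
  - rewrite Rplus_0_r. f_equal; lia.
  - rewrite Rplus_0_l. f_equal; lia.
  - ring.
Qed.

Lemma sum_n_odd_delta (q : nat) (c : R) :
  2 * sum_n (fun i => if Nat.eqb (2 * i + 1) q then c else 0) q = (1 - (-1) ^ q) * c.
Proof.
  destruct (Nat.Even_or_Odd q) as [[p Hp]|[p Hp]].
  - rewrite (sum_n_ext_R _ (fun _ => 0 * 0)).
    + rewrite sum_n_Rmult_l, Hp, pow_1_even; ring.
    + intros i. destruct (Nat.eqb_spec (2 * i + 1) q); [lia|ring].
  - rewrite (sum_n_ext_R _ (fun i => if Nat.eqb i p then c else 0)).
    + rewrite (sum_n_delta (fun _ => c)).
      destruct (Nat.leb_spec p q); [|lia].
      rewrite Hp, Nat.add_1_r, pow_1_odd; ring.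
    + intros i. destruct (Nat.eqb_spec (2 * i + 1) q), (Nat.eqb_spec i p); try lia; easy.
Qed.

Lemma sum_2k1_k2_ext (q : nat) (F F' : nat -> nat -> R) :
  (forall i j, F i j = F' i j) -> sum_2k1_k2 q F = sum_2k1_k2 q F'.
Proof.
  intros HF. unfold sum_2k1_k2. apply sum_n_ext_R; intros i; apply sum_n_ext_R; intros j.
  now rewrite HF.
Qed.

Lemma sum_2k1_k2_scal (q : nat) (c : R) (F : nat -> nat -> R) :
  sum_2k1_k2 q (fun i j => c * F i j) = c * sum_2k1_k2 q F.
Proof.
  unfold sum_2k1_k2. rewrite <- sum_n_Rmult_l. apply sum_n_ext_R; intros i.
  rewrite <- sum_n_Rmult_l. apply sum_n_ext_R; intros j.
  destruct (Nat.eqb _ _); ring.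
Qed.

(** The geometric sum identity at [a] minus the one at [- a]: even powers of [a] cancel and odd ones
    double. In the induction, raising [k2] brings out a factor [/ k], and the terms with [k2 = 0]
    appear only for odd [q]. *)
Lemma sum_2k1_k2_partial_fractions (q : nat) (a k : R) :
  (1 <= q)%nat -> a <> 0 -> k <> 0 -> k - a <> 0 -> k + a <> 0 ->
  2 * sum_2k1_k2 q (fun i j => / a ^ (2 * i + 1) * / k ^ (j + 2))
  = / a ^ q * (/ (k - a) - / k) - (-1) ^ q * / a ^ q * (/ (k + a) - / k)
    - / k ^ q * (/ (k - a) - / (k + a)).
Proof.
  intros Hq Ha Hk Hka Hka'.
  induction Hq as [|q Hq IH].
  - rewrite sum_2k1_k2_eq, sum_n_S, sum_n_0. simpl. field. auto.
  - rewrite sum_2k1_k2_S.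
    rewrite (sum_2k1_k2_ext q _
      (fun i j => / k * (/ a ^ (2 * i + 1) * / k ^ (j + 2)))).
    2: { intros i j. simpl Nat.add. simpl pow. field.
         split; [|split]; try apply pow_nonzero; auto. }
    rewrite (sum_n_ext_R (fun i => if Nat.eqb (2 * i + 1) q then _ else 0)
      (fun i => if Nat.eqb (2 * i + 1) q then / a ^ q * / k ^ 2 else 0)).
    2: { intros i. now destruct (Nat.eqb_spec (2 * i + 1) q) as [->|]. }
    rewrite Rmult_plus_distr_l, sum_n_odd_delta, sum_2k1_k2_scal.
    replace (2 * (/ k * sum_2k1_k2 q (fun i j => / a ^ (2 * i + 1) * / k ^ (j + 2))))
      with (/ k * (2 * sum_2k1_k2 q (fun i j => / a ^ (2 * i + 1) * / k ^ (j + 2))))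
      by ring.
    rewrite IH. simpl pow. field.
    repeat split; try apply pow_nonzero; auto.
Qed.

(** * Summation of the partial fraction identity *)

Lemma is_series_ext_R (f g : nat -> R) (l : R) :
  (forall n, f n = g n) -> is_series f l -> is_series g l.
Proof. exact (is_series_ext f g l). Qed.

Lemma is_series_Rplus (f g : nat -> R) (lf lg : R) :
  is_series f lf -> is_series g lg -> is_series (fun n => f n + g n) (lf + lg).
Proof. exact (is_series_plus f g lf lg). Qed.

Lemma is_series_Rmult_l (c : R) (f : nat -> R) (l : R) :
  is_series f l -> is_series (fun n => c * f n) (c * l).
Proof. exact (is_series_scal c f l). Qed.

Lemma is_series_sum_2k1_k2 (q : nat) (F : nat -> nat -> nat -> R) (l : nat -> nat -> R) :
  (forall i j, is_series (F i j) (l i j)) ->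
  is_series (fun k => sum_2k1_k2 q (fun i j => F i j k)) (sum_2k1_k2 q l).
Proof.
  intros HF. unfold sum_2k1_k2.
  apply (is_series_sum_n (fun i k => sum_n (fun j =>
    if Nat.eqb (2 * i + j + 2) q then F i j k else 0) q)).
  intros i.
  apply (is_series_sum_n (fun j k => if Nat.eqb (2 * i + j + 2) q then F i j k else 0)).
  intros j. destruct (Nat.eqb (2 * i + j + 2) q); [apply HF|].
  pose proof (is_series_Rmult_l 0 _ _ (HF i j)) as H. rewrite Rmult_0_l in H.
  apply is_series_ext_R with (2 := H); intros k; ring.
Qed.

(** Closed form of the [k]-sum for the pair [a = half n] and [a = - half n]: two digamma values,
    minus the zeta terms of the geometric sum. *)
Definition residue_term (q n : nat) : R :=
  (-1) ^ n * / half n ^ q * (2 * ln 2 - h n)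
  + - (-1) ^ q * ((-1) ^ n * / half n ^ q) * (2 * ln 2 - h (S n))
  + - 2 * sum_2k1_k2 q (fun i j => (-1) ^ n / half n ^ (2 * i + 1) * zeta (j + 2)).

(** The partial fraction identity is solved for its [/ k ^ q] part and summed over [k]. *)
Lemma is_series_residue_term (q n : nat) :
  (1 <= q)%nat ->
  is_series
    (fun k => / INR (S k) ^ q *
       ((-1) ^ n * (/ (INR (S k) - half n) - / (INR (S k) + half n))))
    (residue_term q n).
Proof.
  intros Hq. unfold residue_term.
  eapply is_series_ext_R; [|apply is_series_Rplus; [apply is_series_Rplus|]];
    [|apply is_series_Rmult_l, is_series_sub_half
     |apply is_series_Rmult_l, is_series_add_half
     |apply is_series_Rmult_l, is_series_sum_2k1_k2; intros i j;
      apply is_series_Rmult_l, is_series_zeta; lia].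
  intros k; cbv beta.
  rewrite (sum_2k1_k2_ext q _ (fun i j =>
    (-1) ^ n * (/ half n ^ (2 * i + 1) * / INR (S k) ^ (j + 2))))
    by (intros; unfold Rdiv; ring).
  rewrite sum_2k1_k2_scal.
  pose proof (half_pos n).
  assert (0 < INR (S k)) by (apply lt_0_INR; lia).
  pose proof (sum_2k1_k2_partial_fractions q (half n) (INR (S k)) Hq ltac:(lra) ltac:(lra)
    (INR_sub_half_neq0 (S k) n) ltac:(lra)) as E.
  set (W := sum_2k1_k2 _ _) in *.
  replace W with (2 * W * / 2) by field. rewrite E. field.
  repeat split; try apply pow_nonzero; try lra. apply INR_sub_half_neq0.
Qed.

(** By finite interchange, the partial sums of [residue_term] are the series of
    [sec_partial N k / k ^ q] over [k]. *)
Lemma is_series_residue_total (q : nat) :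
  (1 <= q)%nat -> is_series (residue_term q) (- PI * zetabar q).
Proof.
  intros Hq. apply is_series_lim, lim_series_sec_partial; [exact Hq|].
  intros N.
  eapply is_series_ext_R;
    [|apply (is_series_sum_n _ _ N (fun n => is_series_residue_term q n Hq))].
  intros k; cbv beta. apply sum_n_Rmult_l.
Qed.

Theorem theorem3p1 (q : nat) (hq : (1 <= q)%nat) :
  (1 + (-1) ^ (q + 1)) * Tbar1 q =
    (-1) ^ (q + 1) * tbar (q + 1)
    - PI * zetabar q
    + ((-1) ^ q - 1) * (2 * ln 2) * tbar q
    + 2 * sum_2k1_k2 q (fun k1 k2 => tbar (2 * k1 + 1) * zeta (k2 + 2)).
Proof.
  (* With the factor moved inside, convergence of the scaled series and its value are obtained
     together. *)
  unfold Tbar1. rewrite <- Series_scal_l. apply is_series_unique.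
  assert (HW : is_series
    (fun n => sum_2k1_k2 q (fun i j => zeta (j + 2) * ((-1) ^ n / half n ^ (2 * i + 1))))
    (sum_2k1_k2 q (fun i j => zeta (j + 2) * tbar (2 * i + 1)))).
  { apply is_series_sum_2k1_k2; intros i j.
    apply is_series_Rmult_l, is_series_tbar; lia. }
  pose proof (is_series_residue_total q hq) as HU.
  pose proof (is_series_tbar q hq) as Ht.
  pose proof (is_series_tbar (q + 1) ltac:(lia)) as Ht'.
  apply (is_series_Rmult_l 2) in HW.
  apply (is_series_Rmult_l (((-1) ^ q - 1) * (2 * ln 2))) in Ht.
  apply (is_series_Rmult_l ((-1) ^ (q + 1))) in Ht'.
  (* By [h (S n) = h n + / half n], [Ht'] cancels the extra term in [/ half n ^ (q + 1)], [Ht] the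
     multiples of [ln 2], and [HW] the zeta terms. What remains of [residue_term] is the scaled
     summand of [Tbar1]. *)
  pose proof (is_series_Rplus _ _ _ _
    (is_series_Rplus _ _ _ _ (is_series_Rplus _ _ _ _ Ht' HU) Ht) HW) as Hall.
  rewrite (sum_2k1_k2_ext q _ (fun i j => tbar (2 * i + 1) * zeta (j + 2))) in Hall
    by (intros; ring).
  match type of Hall with is_series _ ?l => replace l with
    ((-1) ^ (q + 1) * tbar (q + 1) - PI * zetabar q
     + ((-1) ^ q - 1) * (2 * ln 2) * tbar q
     + 2 * sum_2k1_k2 q (fun k1 k2 => tbar (2 * k1 + 1) * zeta (k2 + 2)))
    in Hall by ring end.
  apply is_series_ext_R with (2 := Hall); intros n; cbv beta.
  unfold residue_term.
  rewrite (sum_2k1_k2_ext q _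
    (fun i j => zeta (j + 2) * ((-1) ^ n / half n ^ (2 * i + 1)))) by (intros; ring).
  fold (half n). rewrite h_S, !Nat.add_1_r. simpl pow.
  pose proof (half_pos n). field.
  repeat split; try apply pow_nonzero; lra.
Qed.
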